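(* Let $X$ be a Banach space and let $0\le\nu\le1$. Then $$H_\nu(X,B)\ge\sqrt{2(1-\rho_B(X))}.$$
   Context: $S_X$ is the unit sphere of $X$. For $x,y\in X$, $x\perp_B y$ (Birkhoff orthogonality) means $\|x+\lambda y\|\ge\|x\|$ for all real $\lambda$. For $0\le\nu\le1$, $$H_\nu(X,B)=\sup\left\{\frac{\|x+y\|^{\nu}\|x-y\|^{1-\nu}+\|x+y\|^{1-\nu}\|x-y\|^{\nu}}{2}:\ x,y\in S_X,\ x\perp_B y\right\},$$ and $$\rho_B(X)=\sup\left\{1-\frac{\|x+y\|}{2}:\ x,y\in S_X,\ x\perp_B y\right\}.$$ *)

(* Defs.v *)
From HB Require Import structures.
From mathcomp Require Import all_boot all_order all_algebra.
From mathcomp Require Import all_classical all_reals all_analysis.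

Set Implicit Arguments.
Unset Strict Implicit.
Unset Printing Implicit Defensive.

Import Order.TTheory GRing.Theory Num.Theory.
Import numFieldNormedType.Exports.

Local Open Scope classical_set_scope.
Local Open Scope ring_scope.

Section BirkhoffConstants.
Context {R : realType}.

Definition unit_sphere (X : normedModType R) : set X := [set x | `|x| = 1].

Definition birkhoff_orthogonal (X : normedModType R) (x y : X) : Prop :=
  forall l : R, `|x| <= `|x + l *: y|.

(* If this fails, no two unit vectors are Birkhoff orthogonal, and the suprema
   below are taken over the empty set (where [sup] returns the junk value 0). *)
Definition dim_ge2 (X : lmodType R) : Prop :=
  exists u v : X, forall a b : R, a *: u + b *: v = 0 -> a = 0 /\ b = 0.

(* [powR] has [0 `^ 0 = 1]; this is never used, since Birkhoff orthogonality
   of unit vectors [x], [y] forces both norms to lie in [1, 2]. For the same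
   reason the sets in [H_B] and [rho_B] are bounded, so the real-valued [sup]
   is the actual supremum as soon as they are nonempty. *)
Definition H_B (X : normedModType R) (nu : R) : R :=
  sup [set r | exists x y : X,
    [/\ unit_sphere x, unit_sphere y, birkhoff_orthogonal x y &
        r = (`|x + y| `^ nu * `|x - y| `^ (1 - nu)
             + `|x + y| `^ (1 - nu) * `|x - y| `^ nu) / 2]].

Definition rho_B (X : normedModType R) : R :=
  sup [set r | exists x y : X,
    [/\ unit_sphere x, unit_sphere y, birkhoff_orthogonal x y &
        r = 1 - `|x + y| / 2]].

End BirkhoffConstants.

(* Main.v *)
Require Import Defs.
From mathcomp Require Import all_boot all_order all_algebra.
From mathcomp Require Import all_classical all_reals all_analysis.
From mathcomp Require Import ring lra.
Import Order.TTheory GRing.Theory Num.Theory.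
Import numFieldNormedType.Exports.
Local Open Scope ring_scope.

(** By AM-GM, the quantity in [H_B] is at least the square root of
    [`|x + y| * `|x - y|] for each admissible pair; orthogonality gives
    [1 <= `|x - y|], and [2 * (1 - rho_B X)] is a lower bound of [`|x + y|].
    So a single admissible pair suffices; it is obtained by minimising
    [`|u + t *: v|] over [t] for linearly independent [u] and [v]. *)

Lemma norm_line_min (R : realType) (X : normedModType R) (u v : X) :
  v != 0 -> exists t0 : R, forall t : R, `|u + t0 *: v| <= `|u + t *: v|.
Proof.
move=> v0; have nv : 0 < `|v| by rewrite normr_gt0.
(* Beyond this radius [|t *: v|] exceeds [2 * |u|], so the triangle inequality makes [|u + t *: v|]
   exceed [|u|], the value at [t = 0]. A minimum over the compact interval [[- M, M]] is therefore
   global. *)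
pose M := 2 * `|u| / `|v|.
have M0 : 0 <= M by rewrite divr_ge0 ?mulr_ge0.
pose f (t : R) : R := `|u + t *: v|.
have fcont : continuous f.
  move=> t; apply: cvg_norm; apply: cvgD; first exact: cvg_cst.
  by apply: cvgZr_tmp; exact: cvg_id.
have NMM : - M <= M by lra.
have [t0 _ min_t0] := EVT_min NMM (continuous_subspaceT fcont).
exists t0 => t; case: (lerP `|t| M) => tM.
  by apply: min_t0; rewrite in_itv /= -ler_norml.
have le0 : f t0 <= `|u|.
  have -> : `|u| = f 0 by rewrite /f scale0r addr0.
  by apply: min_t0; rewrite in_itv /=; lra.
apply: le_trans le0 _.
have : `|t *: v| <= `|u + t *: v| + `|u|.
  by rewrite -[X in `|X| <= _](addKr u) addrC ler_normB.
have : 2 * `|u| < `|t| * `|v| by rewrite -ltr_pdivrMr.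
rewrite normrZ; lra.
Qed.

(** The point [w] of least norm on the line [u + t *: v] is orthogonal to [v]; independence makes
    both nonzero, so they can be normalised. *)
Lemma exists_birkhoff_orthogonal (R : realType) (X : normedModType R) :
  dim_ge2 X -> exists x y : X,
    [/\ unit_sphere x, unit_sphere y & birkhoff_orthogonal x y].
Proof.
move=> [u [v uv]].
have v0 : v != 0.
  apply/eqP => v0; have [] := uv 0 1.
    by rewrite v0 scale0r scaler0 addr0.
  by move=> _ /eqP; rewrite oner_eq0.
have [t0 min_t0] := norm_line_min R X u v v0.
set w := u + t0 *: v in min_t0.
have w0 : w != 0.
  apply/eqP => w0; have [] := uv 1 t0.
    by rewrite scale1r.
  by move=> /eqP; rewrite oner_eq0.
have nv : `|v| != 0 by rewrite normr_eq0.
have nw : `|w| != 0 by rewrite normr_eq0.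
have unit z : `|z| != 0 -> unit_sphere (`|z|^-1 *: z : X).
  by move=> nz; rewrite /unit_sphere /= normrZ normfV normr_id mulVf.
exists (`|w|^-1 *: w), (`|v|^-1 *: v); split; [exact: unit|exact: unit|].
(* Up to the factor [|w|^-1], the perturbed vector is again a point of the line on which [w] has
   least norm. *)
move=> l; have -> : `|w|^-1 *: w + l *: (`|v|^-1 *: v) =
    `|w|^-1 *: (u + (t0 + `|w| * l / `|v|) *: v).
  rewrite scalerDl addrA -/w [RHS]scalerDr !scalerA; congr (_ + _).
  by congr (_ *: _); rewrite !mulrA mulVf ?mul1r.
by rewrite !normrZ ler_wpM2l // min_t0.
Qed.

Lemma birkhoff_normD_ge1 (R : realType) (X : normedModType R) (x y : X) :
  unit_sphere x -> birkhoff_orthogonal x y -> 1 <= `|x + y|.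
Proof. by move=> <- /(_ 1); rewrite scale1r. Qed.

Lemma birkhoff_normB_ge1 (R : realType) (X : normedModType R) (x y : X) :
  unit_sphere x -> birkhoff_orthogonal x y -> 1 <= `|x - y|.
Proof. by move=> <- /(_ (-1)); rewrite scaleN1r. Qed.

(** The exponents sum to 1, so [c] splits as [c ^ nu * c ^ (1 - nu)] and the factors compare
    separately. With [c = 2] this bounds the set in [H_B]. *)
Lemma powR_mix_le (R : realType) (a b c nu : R) :
  0 <= nu <= 1 -> 0 <= a <= c -> 0 <= b <= c -> 0 < c ->
  a `^ nu * b `^ (1 - nu) <= c.
Proof.
move=> /andP[nu0 nu1] /andP[a0 ac] /andP[b0 bc] c0.
have -> : c = c `^ nu * c `^ (1 - nu).
  rewrite -powRD; last by rewrite (gt_eqF c0) implybT.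
  by rewrite addrC subrK powRr1 // ltW.
by apply: ler_pM; rewrite ?powR_ge0 // ge0_ler_powR ?nnegrE ?subr_ge0 //;
  exact: ltW.
Qed.

Lemma sqrt_le_powR_mix (R : realType) (a b nu : R) : 0 < a -> 0 < b ->
  Num.sqrt (a * b) <=
  (a `^ nu * b `^ (1 - nu) + a `^ (1 - nu) * b `^ nu) / 2.
Proof.
move=> a0 b0.
have powK (c : R) : 0 < c -> c `^ nu * c `^ (1 - nu) = c.
  move=> c0; rewrite -powRD; last by rewrite (gt_eqF c0) implybT.
  by rewrite addrC subrK powRr1 // ltW.
set A := a `^ nu * _; set B := _ * b `^ nu.
have A0 : 0 <= A by apply: mulr_ge0; exact: powR_ge0.
have B0 : 0 <= B by apply: mulr_ge0; exact: powR_ge0.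
(* In [A * B] the exponents of [a], and likewise those of [b], sum to 1; AM-GM then applies to [A]
   and [B]. *)
have -> : a * b = A * B.
  rewrite -{1}(powK a a0) -{1}(powK b b0) /A /B; ring.
have r0 : 0 <= (A + B) / 2 by rewrite divr_ge0 ?addr_ge0.
rewrite -[leRHS]ger0_norm // -sqrtr_sqr ler_wsqrtr //.
have := sqr_ge0 (A - B); nra.
Qed.

Lemma birkhoff_le_rho_B (R : realType) (X : normedModType R) (x y : X) :
  unit_sphere x -> unit_sphere y -> birkhoff_orthogonal x y ->
  1 - `|x + y| / 2 <= rho_B X.
Proof.
move=> x1 y1 xy; apply: ub_le_sup; last by exists x, y.
exists 1 => _ [x' [y' [_ _ _ ->]]].
by rewrite gerBl divr_ge0.
Qed.

Lemma birkhoff_le_H_B (R : realType) (X : normedModType R) (nu : R) (x y : X) :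
  0 <= nu <= 1 ->
  unit_sphere x -> unit_sphere y -> birkhoff_orthogonal x y ->
  (`|x + y| `^ nu * `|x - y| `^ (1 - nu)
   + `|x + y| `^ (1 - nu) * `|x - y| `^ nu) / 2 <= H_B X nu.
Proof.
move=> nu01 x1 y1 xy; apply: ub_le_sup; last by exists x, y.
(* By the triangle inequality, sums and differences of unit vectors have norm at most 2, hence so
   does each of the two mixed products. *)
exists 2 => _ [x' [y' [x'1 y'1 _ ->]]].
have hD : 0 <= `|x' + y'| <= 2.
  by rewrite normr_ge0 (le_trans (ler_normD _ _)) // x'1 y'1.
have hB : 0 <= `|x' - y'| <= 2.
  by rewrite normr_ge0 (le_trans (ler_normB _ _)) // x'1 y'1.
have := powR_mix_le R _ _ _ _ nu01 hD hB (ltr0Sn _ 1).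
have := powR_mix_le R _ _ _ _ nu01 hB hD (ltr0Sn _ 1).
rewrite [X in X <= _ -> _]mulrC; lra.
Qed.

Theorem proposition3p7 (R : realType) (X : completeNormedModType R)
    (hX : dim_ge2 X) (nu : R) (hnu0 : 0 <= nu) (hnu1 : nu <= 1) :
  H_B X nu >= Num.sqrt (2 * (1 - rho_B X)).
Proof.
have [x [y [x1 y1 xy]]] := exists_birkhoff_orthogonal R X hX.
have nu01 : 0 <= nu <= 1 by rewrite hnu0.
apply: le_trans (birkhoff_le_H_B R X nu x y nu01 x1 y1 xy).
have D1 := birkhoff_normD_ge1 R X x y x1 xy.
have B1 := birkhoff_normB_ge1 R X x y x1 xy.
have rho := birkhoff_le_rho_B R X x y x1 y1 xy.
have D0 : 0 < `|x + y| by lra.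
have B0 : 0 < `|x - y| by lra.
(* The norm [|x + y|] separates the two radicands: [rho] puts [2 * (1 - rho_B X)] below it, and
   [1 <= |x - y|] puts the product above it. *)
apply: le_trans (sqrt_le_powR_mix R _ _ nu D0 B0); rewrite ler_wsqrtr //.
apply: (@le_trans _ _ `|x + y|); first lra.
by rewrite ler_peMr.
Qed.
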